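(* Let $n\in\{1,2,3\}$ and let $A\in\mathcal{M}(n,\mathbb{H})$ be any quaternionic matrix. Then there exists a characteristic function $\mu$ of $A$, of one of the types (P) or (R) described in the context, whose extension to a map $\mu\colon\mathcal{M}(n,\mathbb{H})\to\mathcal{M}(n,\mathbb{H})$ (as described in the context) verifies the Hamilton-Cayley theorem, that is, $\mu(A)=0$.
   Context: $\mathbb{H}$ is the algebra of quaternions with norm $\vert\cdot\vert$, $\mathcal{M}(n,\mathbb{H})$ is the set of $n\times n$ quaternionic matrices, and $I$ is the identity matrix. Study's determinant: write $A=X+jY$ with $X,Y\in\mathcal{M}(n,\mathbb{C})$ and let $c(A)=\begin{bmatrix}X&-\overline{Y}\\ Y&\overline{X}\end{bmatrix}\in\mathcal{M}(2n,\mathbb{C})$; then $\det c(A)\ge 0$ and $\mathrm{Sdet}(A)=(\det c(A))^{1/2}$. Characteristic function: a map $\mu\colon\mathbb{H}\to\mathbb{H}$ is a characteristic function of $A$ if, up to a constant, $\vert\mu(\lambda)\vert=\mathrm{Sdet}(A-\lambda I)$ for all $\lambda\in\mathbb{H}$; i.e. there is a real constant $k>0$ with $\vert\mu(\lambda)\vert=k\,\mathrm{Sdet}(A-\lambda I)$ for all $\lambda$. Type (P), polynomial. A quaternionic polynomial is a formal finite sum of monomials $q_1\lambda q_2\lambda\cdots q_k\lambda q_{k+1}$ with quaternionic coefficients $q_i$ (constants are allowed); it defines a function on $\mathbb{H}$. Its extension to matrices is obtained by replacing $\lambda$ by a matrix $B$ and each quaternion $q$ by the matrix $qI$, so that the monomial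 becomes $(q_1I)B(q_2I)B\cdots(q_kI)B(q_{k+1}I)$. Type (R), rational; only for $n=3$ and $A=\begin{bmatrix}a&b&c\\ f&g&h\\ p&q&r\end{bmatrix}$ with $c\neq0$. Let $\lambda_0=g-hc^{-1}b$, $f_0=f-hc^{-1}(a-\lambda_0)$, $q_0=q-(r-\lambda_0)c^{-1}b$. Define $\mu(\lambda_0)=q_0f_0$, and for $\lambda\neq\lambda_0$ $$\mu(\lambda)=(\lambda_0-\lambda)\Big[\big(p-(r-\lambda)c^{-1}(a-\lambda)\big)-\big(q-(r-\lambda)c^{-1}b\big)(\lambda_0-\lambda)^{-1}\big(f-hc^{-1}(a-\lambda)\big)\Big].$$ Its extension to $B\in\mathcal{M}(3,\mathbb{H})$ is: $\mu(B)=q_0f_0I$ if $\lambda_0I-B$ is not invertible, and, if $\lambda_0I-B$ is invertible, $$\mu(B)=(\lambda_0I-B)\Big[\big(pI-(rI-B)c^{-1}(aI-B)\big)-\big(qI-(rI-B)c^{-1}b\big)(\lambda_0I-B)^{-1}\big(fI-hc^{-1}(aI-B)\big)\Big],$$ where a quaternion $s$ multiplying a matrix stands for the matrix $sI$. *)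

(* Defs.v *)
From HB Require Import structures.
From mathcomp Require Import all_boot all_order all_algebra.
From mathcomp Require Import ring lra.
From mathcomp Require Import boolp classical_sets reals.
From mathcomp Require Import complex.

Set Implicit Arguments.
Unset Strict Implicit.
Unset Printing Implicit Defensive.
Import Order.TTheory GRing.Theory Num.Theory.
Local Open Scope ring_scope.

(* [Quat a b c d] is the quaternion a + b i + c j + d k. *)
Record quat (R : realType) := Quat { q_re : R; q_i : R; q_j : R; q_k : R }.

Section QuatRing.
Variable R : realType.
Implicit Types x y z : quat R.

Definition quat_to_tuple x := (q_re x, q_i x, q_j x, q_k x).
Definition quat_of_tuple (t : R * R * R * R) :=
  let: (a, b, c, d) := t in Quat a b c d.
Lemma quat_to_tupleK : cancel quat_to_tuple quat_of_tuple.
Proof. by case. Qed.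

HB.instance Definition _ :=
  Choice.copy (quat R) (can_type quat_to_tupleK).

Definition addq x y :=
  Quat (q_re x + q_re y) (q_i x + q_i y) (q_j x + q_j y) (q_k x + q_k y).
Definition oppq x := Quat (- q_re x) (- q_i x) (- q_j x) (- q_k x).
Definition mulq x y :=
  let: Quat a b c d := x in
  let: Quat a' b' c' d' := y in
  Quat (a * a' - b * b' - c * c' - d * d')
       (a * b' + b * a' + c * d' - d * c')
       (a * c' - b * d' + c * a' + d * b')
       (a * d' + b * c' - c * b' + d * a').

Lemma addqA : associative addq.
Proof. by move=> x y z; rewrite /addq /= !addrA. Qed.
Lemma addqC : commutative addq.
Proof. by move=> [a b c d] [e f g h]; rewrite /addq /=; congr Quat; rewrite addrC. Qed.
Lemma add0q : left_id (Quat 0 0 0 0) addq.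
Proof. by move=> [a b c d]; rewrite /addq /= !add0r. Qed.
Lemma addNq : left_inverse (Quat 0 0 0 0) oppq addq.
Proof. by move=> [a b c d]; rewrite /addq /oppq /= !addNr. Qed.

HB.instance Definition _ :=
  GRing.isZmodule.Build (quat R) addqA addqC add0q addNq.

Lemma mulqA : associative mulq.
Proof. by move=> [a b c d] [e f g h] [l m n o]; rewrite /mulq; congr Quat; ring. Qed.
Lemma mul1q : left_id (Quat 1 0 0 0) mulq.
Proof. by move=> [a b c d]; rewrite /mulq; congr Quat; ring. Qed.
Lemma mulq1 : right_id (Quat 1 0 0 0) mulq.
Proof. by move=> [a b c d]; rewrite /mulq; congr Quat; ring. Qed.
Lemma mulqDl : left_distributive mulq addq.
Proof. by move=> [a b c d] [e f g h] [l m n o]; rewrite /mulq /addq /=; congr Quat; ring. Qed.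
Lemma mulqDr : right_distributive mulq addq.
Proof. by move=> [a b c d] [e f g h] [l m n o]; rewrite /mulq /addq /=; congr Quat; ring. Qed.
Lemma oneq_neq0 : Quat 1 0 0 0 != 0 :> quat R.
Proof. by apply/eqP => -[] /eqP; rewrite oner_eq0. Qed.

HB.instance Definition _ :=
  GRing.Zmodule_isNzRing.Build (quat R) mulqA mul1q mulq1 mulqDl mulqDr oneq_neq0.

Definition qnormsq x := q_re x ^+ 2 + q_i x ^+ 2 + q_j x ^+ 2 + q_k x ^+ 2.
Definition qnorm x : R := Num.sqrt (qnormsq x).

Definition invq x :=
  let s := (qnormsq x)^-1 in
  Quat (s * q_re x) (- (s * q_i x)) (- (s * q_j x)) (- (s * q_k x)).

Lemma qnormsq_eq0 x : (qnormsq x == 0) = (x == 0).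
Proof.
case: x => a b c d; rewrite /qnormsq /=.
apply/idP/eqP => [|[-> -> -> ->]]; last by rewrite expr0n /= !addr0.
rewrite !paddr_eq0 ?addr_ge0 ?sqr_ge0 // !sqrf_eq0.
by move=> /andP[/andP[/andP[/eqP-> /eqP->] /eqP->] /eqP->].
Qed.

Lemma mulVq : {in [pred x : quat R | x != 0], left_inverse 1 invq *%R}.
Proof.
move=> x; rewrite inE -qnormsq_eq0; case: x => a b c d; rewrite /qnormsq /= => nz.
by congr Quat; rewrite /qnormsq /=; field.
Qed.
Lemma mulqV : {in [pred x : quat R | x != 0], right_inverse 1 invq *%R}.
Proof.
move=> x; rewrite inE -qnormsq_eq0; case: x => a b c d; rewrite /qnormsq /= => nz.
by congr Quat; rewrite /qnormsq /=; field.
Qed.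
Lemma quat_unitP x y : y * x = 1 /\ x * y = 1 -> x \in [pred x : quat R | x != 0].
Proof.
move=> [yx1 _]; rewrite inE; apply/eqP => x0.
by move/eqP: yx1; rewrite x0 mulr0 eq_sym oner_eq0.
Qed.
Lemma invq_out : {in [predC [pred x : quat R | x != 0]], invq =1 id}.
Proof.
move=> x; rewrite !inE negbK => /eqP ->.
by rewrite /invq /= !mulr0 !oppr0.
Qed.

HB.instance Definition _ :=
  GRing.NzRing_hasMulInverse.Build (quat R) mulVq mulqV quat_unitP invq_out.

End QuatRing.

Section Study.
Variable R : realType.

Definition quat_of_complex (z : R[i]) : quat R :=
  Quat (complex.Re z) (complex.Im z) 0 0.

(* The complex numbers x, y with q = x + j y; note that j i = - k. *)
Definition quatX (q : quat R) : R[i] := Complex (q_re q) (q_i q).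
Definition quatY (q : quat R) : R[i] := Complex (q_j q) (- q_k q).

Lemma quat_XjY (q : quat R) :
  q = quat_of_complex (quatX q) + Quat 0 0 1 0 * quat_of_complex (quatY q).
Proof. by case: q => a b c d; congr Quat => /=; ring. Qed.

Definition complex_mx n (A : 'M[quat R]_n) : 'M[R[i]]_(n + n) :=
  let X := map_mx quatX A in
  let Y := map_mx quatY A in
  block_mx X (- map_mx (@conjc R) Y) Y (map_mx (@conjc R) X).

(* The determinant below is a nonnegative real number, so taking its real part
   only changes its type from [R[i]] to [R]. *)
Definition Sdet n (A : 'M[quat R]_n) : R :=
  Num.sqrt (complex.Re (\det (complex_mx A))).

Definition characteristic_function n (A : 'M[quat R]_n)
    (mu : quat R -> quat R) : Prop :=
  exists2 k : R, 0 < k & forall l, qnorm (mu l) = k * Sdet (A - l%:M).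

End Study.

Section Polynomial.
Variable R : realType.

(* The monomial q_1 X q_2 X ... q_k X q_(k+1) is encoded as the pair of q_1 and
   the sequence [:: q_2; ...; q_(k+1)], and a polynomial is a formal finite sum
   of such monomials. *)
Definition qmonomial := (quat R * seq (quat R))%type.
Definition qpoly := seq qmonomial.

(* Evaluation at x in a ring S, the coefficients being sent to S by f. *)
Definition qmonomial_eval (S : pzRingType) (f : quat R -> S) (x : S)
    (m : qmonomial) : S :=
  foldl (fun acc q => acc * x * f q) (f m.1) m.2.
Definition qpoly_eval (S : pzRingType) (f : quat R -> S) (P : qpoly) (x : S) : S :=
  \sum_(m <- P) qmonomial_eval f x m.

Definition qpoly_fun (P : qpoly) : quat R -> quat R := qpoly_eval id P.
Definition qpoly_ext n (P : qpoly) : 'M[quat R]_n -> 'M[quat R]_n :=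
  qpoly_eval (fun q => q%:M) P.

End Polynomial.

(* MathComp's [unitmx] and [invmx] require commutative coefficients. *)
Definition mx_inverse_of (R : realType) n (B C : 'M[quat R]_n) : Prop :=
  B *m C = 1%:M /\ C *m B = 1%:M.
Definition mx_invertible (R : realType) n (B : 'M[quat R]_n) : Prop :=
  exists C, mx_inverse_of B C.
Definition mx_inv (R : realType) n (B : 'M[quat R]_n) : 'M[quat R]_n :=
  xget 0 [set C | mx_inverse_of B C].

Section Rational.
Variable R : realType.
Implicit Type A : 'M[quat R]_3.

Definition rat_l0 A : quat R :=
  let b := A 0 1 in let c := A 0 2 in let g := A 1 1 in let h := A 1 2 in
  g - h * c^-1 * b.

Definition rat_f0 A : quat R :=
  let a := A 0 0 in let c := A 0 2 in let f := A 1 0 in let h := A 1 2 in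
  f - h * c^-1 * (a - rat_l0 A).

Definition rat_q0 A : quat R :=
  let b := A 0 1 in let c := A 0 2 in let q := A 2 1 in let r := A 2 2 in
  q - (r - rat_l0 A) * c^-1 * b.

Definition rat_fun A (l : quat R) : quat R :=
  let a := A 0 0 in let b := A 0 1 in let c := A 0 2 in
  let f := A 1 0 in let h := A 1 2 in
  let p := A 2 0 in let q := A 2 1 in let r := A 2 2 in
  let l0 := rat_l0 A in
  if l == l0 then rat_q0 A * rat_f0 A
  else (l0 - l) *
    ((p - (r - l) * c^-1 * (a - l))
     - (q - (r - l) * c^-1 * b) * (l0 - l)^-1 * (f - h * c^-1 * (a - l))).

Definition rat_ext A (B : 'M[quat R]_3) : 'M[quat R]_3 :=
  let a := A 0 0 in let b := A 0 1 in let c := A 0 2 in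
  let f := A 1 0 in let h := A 1 2 in
  let p := A 2 0 in let q := A 2 1 in let r := A 2 2 in
  let l0 := rat_l0 A in
  if `[< mx_invertible (l0%:M - B) >] then
    (l0%:M - B) *m
      ((p%:M - (r%:M - B) *m (c^-1)%:M *m (a%:M - B))
       - (q%:M - (r%:M - B) *m (c^-1 * b)%:M) *m mx_inv (l0%:M - B)
         *m (f%:M - (h * c^-1)%:M *m (a%:M - B)))
  else (rat_q0 A * rat_f0 A)%:M.

End Rational.

(* [mu_with_extension A mu muM]: mu is a map of one of the two admissible types
   (polynomial, or rational for A) and muM is its extension to matrices. *)
Inductive mu_with_extension (R : realType) : forall n : nat, 'M[quat R]_n ->
    (quat R -> quat R) -> ('M[quat R]_n -> 'M[quat R]_n) -> Prop :=
| Type_P n (A : 'M[quat R]_n) (P : qpoly R) :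
    mu_with_extension A (qpoly_fun P) (@qpoly_ext R n P)
| Type_R (A : 'M[quat R]_3) : A 0 2 != 0 ->
    mu_with_extension A (rat_fun A) (rat_ext A).

(* Main.v *)
From HB Require Import structures.
From mathcomp Require Import all_boot all_order all_fingroup all_algebra.
From mathcomp Require Import ring.
From mathcomp Require Import boolp classical_sets reals.
From mathcomp Require Import complex.
Require Import Defs.

Set Implicit Arguments.
Unset Strict Implicit.
Unset Printing Implicit Defensive.
Import Order.TTheory GRing.Theory Num.Theory.
Local Open Scope ring_scope.

(* Unitriangular column operations over the quaternions followed by a column
   permutation bring [A - l I] to lower triangular form, and the Study
   determinant of a lower triangular matrix is the product of the norms of its
   diagonal entries; this yields [mu].  If [n <= 2] or [A 0 2 = 0], only
   inverses of constants occur, [mu] is a polynomial, and [mu A = 0] is an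
   identity of noncommutative rings.  If [n = 3] and [A 0 2 != 0], [mu] is the
   rational function of type (R).  When [W = l0 I - A] is not invertible, its
   Study determinant vanishes, hence so does [mu l0 = q0 f0].  When [W] is
   invertible, [mu A] is [W (P - Q W^-1 F)]; the first row of [W^-1] is
   [z = f0^-1 (h c^-1, -1, 0)], and with the unit rows [e0], [e1] one has
   [z W = e0] and [z F = - e1], and there are [X] and [Y] without inverses other
   than [c^-1] such that [Q = X e0 + Y W] and [P = Y F - X e1]; so
   [Q W^-1 F = (X z + Y) F = P]. *)

(** * Identities of noncommutative rings *)

(** Syntax for a proof by reflection: each side of an identity is expanded into signed words in its
    atoms, and the two collections of words are compared up to order. *)
Inductive ncexpr :=
  | NCVar of nat | NCZero | NCOne
  | NCAdd of ncexpr & ncexpr | NCOpp of ncexpr | NCMul of ncexpr & ncexpr.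

Section NoncommutativeRing.
Variable S : unitRingType.

Fixpoint nc_eval (env : seq S) e : S :=
  match e with
  | NCVar i => env`_i
  | NCZero => 0
  | NCOne => 1
  | NCAdd e1 e2 => nc_eval env e1 + nc_eval env e2
  | NCOpp e1 => - nc_eval env e1
  | NCMul e1 e2 => nc_eval env e1 * nc_eval env e2
  end.

Definition nc_env (us vs : seq S) := foldr (fun u l => [:: u, u^-1 & l]) vs us.

(* In [nc_env us vs] the [i]-th unit and its inverse have the indices [2 i] and
   [2 i + 1]. *)
Definition nc_inverse k i j := [&& i != j, i./2 == j./2 & i./2 < k]%N.

(** Free reduction: on a reduced tail, only its first letter can cancel the new one. *)
Definition nc_cons k i w :=
  if w is j :: w' then if nc_inverse k i j then w' else i :: w else [:: i].
Definition nc_cat k u v := foldr (nc_cons k) v u.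

(* The words occurring with coefficient [1], and those with coefficient [-1]. *)
Fixpoint nc_words k e : seq (seq nat) * seq (seq nat) :=
  match e with
  | NCVar i => ([:: [:: i]], [::])
  | NCZero => ([::], [::])
  | NCOne => ([:: [::]], [::])
  | NCAdd e1 e2 => let: (p1, n1) := nc_words k e1 in
                   let: (p2, n2) := nc_words k e2 in (p1 ++ p2, n1 ++ n2)
  | NCOpp e1 => let: (p, n) := nc_words k e1 in (n, p)
  | NCMul e1 e2 => let: (p1, n1) := nc_words k e1 in
                   let: (p2, n2) := nc_words k e2 in
                   let pr := allpairs (nc_cat k) in
                   (pr p1 p2 ++ pr n1 n2, pr p1 n2 ++ pr n1 p2)
  end.

(** Negative words are moved to the other side, so opposite words within one expression never have
    to be cancelled. *)
Definition nc_equal k e1 e2 :=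
  let: (p1, n1) := nc_words k e1 in
  let: (p2, n2) := nc_words k e2 in perm_eq (p1 ++ n2) (n1 ++ p2).

Lemma nc_inverseP us vs i j : all (fun u => u \is a GRing.unit) us ->
  nc_inverse (size us) i j -> (nc_env us vs)`_i * (nc_env us vs)`_j = 1.
Proof.
elim: us i j => [|u us IH] i j /=; first by rewrite /nc_inverse ltn0 !andbF.
case/andP=> uu uus; case: i j => [|[|i]] [|[|j]] // nij.
- by rewrite mulrV.
- by rewrite mulVr.
- by apply: IH.
Qed.

Section Correct.
Variables (us vs : seq S).
Hypothesis uus : all (fun u => u \is a GRing.unit) us.
Let k := size us.
Let env := nc_env us vs.
Let word_eval (w : seq nat) := \prod_(i <- w) env`_i.
Let words_eval (ws : seq (seq nat)) := \sum_(w <- ws) word_eval w.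

Lemma nc_catE u v : word_eval (nc_cat k u v) = word_eval u * word_eval v.
Proof.
elim: u => [|i u IH] /=; first by rewrite /word_eval big_nil mul1r.
rewrite [word_eval (i :: u)]big_cons -mulrA -IH.
case: (nc_cat _ _ _) => [|j w] /=; first by rewrite /word_eval big_cons.
case: ifP => ij; last by rewrite /word_eval big_cons.
by rewrite /word_eval big_cons mulrA nc_inverseP // mul1r.
Qed.

Lemma nc_allpairsE p q :
  words_eval (allpairs (nc_cat k) p q) = words_eval p * words_eval q.
Proof.
rewrite /words_eval mulr_suml; elim: p => [|u p IH]; first by rewrite !big_nil.
rewrite /= big_cat big_map big_cons IH mulr_sumr; congr (_ + _).
by apply: eq_bigr => v _; rewrite nc_catE.
Qed.

Lemma nc_wordsE e :
  nc_eval env e = words_eval (nc_words k e).1 - words_eval (nc_words k e).2.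
Proof.
have nil0 : words_eval [::] = 0 by apply: big_nil.
have catE p q : words_eval (p ++ q) = words_eval p + words_eval q.
  by apply: big_cat.
elim: e => [i|||e1 IH1 e2 IH2|e IH|e1 IH1 e2 IH2] /=.
- by rewrite nil0 subr0 /words_eval big_seq1 /word_eval big_seq1.
- by rewrite nil0 subr0.
- by rewrite nil0 subr0 /words_eval big_seq1 /word_eval big_nil.
- rewrite IH1 IH2; case: (nc_words k e1) (nc_words k e2) => [p1 n1] [p2 n2] /=.
  by rewrite !catE opprD addrACA.
- by rewrite IH; case: (nc_words k e) => [p n] /=; rewrite opprB.
- rewrite IH1 IH2; case: (nc_words k e1) (nc_words k e2) => [p1 n1] [p2 n2] /=.
  by rewrite !catE !nc_allpairsE mulrBl !mulrBr opprB opprD addrACA.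
Qed.

Lemma nc_correct e1 e2 : nc_equal k e1 e2 -> nc_eval env e1 = nc_eval env e2.
Proof.
rewrite /nc_equal !nc_wordsE.
case: (nc_words k e1) (nc_words k e2) => [p1 n1] [p2 n2] /= /(perm_big _) E.
have {}E : words_eval (p1 ++ n2) = words_eval (n1 ++ p2) by apply: E.
move: E; rewrite /words_eval !big_cat /= => E.
by apply/eqP; rewrite subr_eq addrAC eq_sym subr_eq addrC -E.
Qed.

End Correct.
End NoncommutativeRing.

Ltac nc_add x l :=
  lazymatch l with
  | [::] => constr:([:: x])
  | x :: _ => l
  | ?y :: ?t => let t' := nc_add x t in constr:(y :: t')
  end.
Ltac nc_index x l :=
  lazymatch l with
  | x :: _ => constr:(0%N)
  | _ :: ?t => let n := nc_index x t in constr:(n.+1)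
  end.
Ltac nc_atoms t l :=
  lazymatch t with
  | @GRing.add _ ?x ?y => let l' := nc_atoms x l in nc_atoms y l'
  | @GRing.mul _ ?x ?y => let l' := nc_atoms x l in nc_atoms y l'
  | @GRing.opp _ ?x => nc_atoms x l
  | @GRing.zero _ => l
  | @GRing.one _ => l
  | _ => nc_add t l
  end.
Ltac nc_reify t l :=
  lazymatch t with
  | @GRing.add _ ?x ?y =>
      let x' := nc_reify x l in let y' := nc_reify y l in constr:(NCAdd x' y')
  | @GRing.mul _ ?x ?y =>
      let x' := nc_reify x l in let y' := nc_reify y l in constr:(NCMul x' y')
  | @GRing.opp _ ?x => let x' := nc_reify x l in constr:(NCOpp x')
  | @GRing.zero _ => constr:(NCZero)
  | @GRing.one _ => constr:(NCOne)
  | _ => let n := nc_index t l in constr:(NCVar n)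
  end.
(** [nc_ring] seeds the atom list with the units and their inverses, two entries per unit, to give
    them the indices that [nc_inverse] expects; dropping them recovers the other atoms. *)
Ltac nc_drop us l :=
  lazymatch us with
  | [::] => l
  | _ :: ?us' => lazymatch l with _ :: _ :: ?l' => nc_drop us' l' end
  end.

(* Proves an identity of noncommutative rings modulo [u * u^-1 = u^-1 * u = 1]
   for the elements [u] of [us]. *)
Ltac nc_ring us :=
  lazymatch goal with
  | |- @eq ?T ?x ?y =>
      let us' := constr:(us : seq T) in
      let us' := lazymatch us' with (?u : _) => u end in
      let l0 := eval cbv beta iota delta [nc_env foldr] in (nc_env us' [::]) in
      let l := nc_atoms x l0 in
      let l := nc_atoms y l in
      let ex := nc_reify x l in
      let ey := nc_reify y l in
      let vs := nc_drop us' l in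
      apply: (@nc_correct _ us' vs _ ex ey);
      [by rewrite /= ?andbT; do ?[apply/andP; split] | by vm_compute]
  end.

(** * Hamilton-Cayley identities *)

Section ExplicitMatrices.
Variable S : unitRingType.
Implicit Types s t : seq (seq S).

(** On concrete lists the matrix operations simplify to lists again, so that a matrix identity
    splits into one ring identity per entry. *)
Definition mxrows n s : 'M[S]_n := \matrix_(i, j) (nth [::] s i)`_j.
Definition mktable n (F : nat -> nat -> S) :=
  mkseq (fun i => mkseq (F i) n) n.

Lemma mxrows_table n F : mxrows n (mktable n F) = \matrix_(i, j) F i j.
Proof. by apply/matrixP => i j; rewrite !mxE nth_mkseq // nth_mkseq. Qed.

Lemma mxrowsD n s t : mxrows n s + mxrows n t =
  mxrows n (mktable n (fun i j => (nth [::] s i)`_j + (nth [::] t i)`_j)).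
Proof. by rewrite mxrows_table; apply/matrixP => i j; rewrite !mxE. Qed.

Lemma mxrowsN n s :
  - mxrows n s = mxrows n (mktable n (fun i j => - (nth [::] s i)`_j)).
Proof. by rewrite mxrows_table; apply/matrixP => i j; rewrite !mxE. Qed.

Lemma mxrowsM n s t : mxrows n s *m mxrows n t =
  mxrows n (mktable n (fun i j =>
    foldr (fun k x => (nth [::] s i)`_k * (nth [::] t k)`_j + x) 0 (iota 0 n))).
Proof.
rewrite mxrows_table; apply/matrixP => i j; rewrite !mxE.
transitivity (\sum_(0 <= k < n) (nth [::] s i)`_k * (nth [::] t k)`_j).
  by rewrite big_mkord; apply: eq_bigr => k _; rewrite !mxE.
by rewrite /index_iota subn0; elim: (iota 0 n) => [|k l IH];
  rewrite ?big_nil ?big_cons ?IH.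
Qed.

Lemma mxrows_scalar n x :
  x%:M = mxrows n (mktable n (fun i j => if i == j then x else 0)).
Proof.
rewrite mxrows_table; apply/matrixP => i j; rewrite !mxE.
by rewrite -val_eqE; case: eqP.
Qed.

Lemma mxrows0 n : 0 = mxrows n (mktable n (fun _ _ => 0)).
Proof. by rewrite mxrows_table; apply/matrixP => i j; rewrite !mxE. Qed.

Lemma mxrows2_eta (A : 'M[S]_2) :
  A = mxrows 2 [:: [:: A 0 0; A 0 1]; [:: A 1 0; A 1 1]].
Proof.
apply/matrixP => i j; rewrite mxE.
by case: i => [[|[|]] ? //]; case: j => [[|[|]] ? //] /=;
  congr (A _ _); apply: val_inj.
Qed.

Lemma mxrows3_eta (A : 'M[S]_3) :
  A = mxrows 3 [:: [:: A 0 0; A 0 1; A 0 2]; [:: A 1 0; A 1 1; A 1 2];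
                   [:: A 2 0; A 2 1; A 2 2]].
Proof.
apply/matrixP => i j; rewrite mxE.
by case: i => [[|[|[|]]] ? //]; case: j => [[|[|[|]]] ? //] /=;
  congr (A _ _); apply: val_inj.
Qed.

End ExplicitMatrices.

Ltac mx_ring us :=
  rewrite !(mxrows_scalar, mxrows0, mxrowsN, mxrowsD, mxrowsM) /mktable /mkseq /=;
  congr mxrows; do !(congr cons); nc_ring us.

(** * Vanishing at [A] for each pattern of zeros above the diagonal *)

Section HamiltonCayley.
Variable S : unitRingType.
Implicit Types a b c d f g h p q r : S.

Lemma HC2_lower a c d (A := mxrows 2 [:: [:: a; 0]; [:: c; d]]) :
  (d%:M - A) *m (a%:M - A) = 0.
Proof. rewrite /A; mx_ring (@nil S). Qed.

Lemma HC2 a b c d (A := mxrows 2 [:: [:: a; b]; [:: c; d]]) :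
  b \is a GRing.unit -> c%:M - (d%:M - A) *m b^-1%:M *m (a%:M - A) = 0.
Proof. move=> ub; rewrite /A; mx_ring [:: b]. Qed.

Lemma HC3_lower a f g p q r
    (A := mxrows 3 [:: [:: a; 0; 0]; [:: f; g; 0]; [:: p; q; r]]) :
  (r%:M - A) *m (g%:M - A) *m (a%:M - A) = 0.
Proof. rewrite /A; mx_ring (@nil S). Qed.

(** By [HC2] for the lower right block, the last two columns of the left factor vanish, and so does
    the first row of [a%:M - A]. *)
Lemma HC3_lblock12 a f g h p q r
    (A := mxrows 3 [:: [:: a; 0; 0]; [:: f; g; h]; [:: p; q; r]]) :
  h \is a GRing.unit ->
  (q%:M - (r%:M - A) *m h^-1%:M *m (g%:M - A)) *m (a%:M - A) = 0.
Proof. move=> uh; rewrite /A; mx_ring [:: h]. Qed.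

(** By [HC2] for the upper left block, the first two rows of the right factor vanish, and so does
    the last column of [r%:M - A]. *)
Lemma HC3_lblock21 a b f g p q r
    (A := mxrows 3 [:: [:: a; b; 0]; [:: f; g; 0]; [:: p; q; r]]) :
  b \is a GRing.unit ->
  (r%:M - A) *m (f%:M - (g%:M - A) *m b^-1%:M *m (a%:M - A)) = 0.
Proof. move=> ub; rewrite /A; mx_ring [:: b]. Qed.

Lemma HC3_hessenberg a b f g h p q r
    (A := mxrows 3 [:: [:: a; b; 0]; [:: f; g; h]; [:: p; q; r]]) :
  b \is a GRing.unit -> h \is a GRing.unit ->
  p%:M - q%:M *m b^-1%:M *m (a%:M - A)
  - (r%:M - A) *m h^-1%:M *m (f%:M - (g%:M - A) *m b^-1%:M *m (a%:M - A)) = 0.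
Proof. move=> ub uh; rewrite /A; mx_ring [:: b; h]. Qed.

(** Over a division ring this gives [f0 != 0]. The row y = (h c^-1, -1, 0) satisfies y W = f0 e0 for
    W = l0 I - A, hence y = f0 e0 V; compare the middle entries. *)
Lemma HC3_rational_f0 a b c f g h p q r V
    (A := mxrows 3 [:: [:: a; b; c]; [:: f; g; h]; [:: p; q; r]])
    (l0 := g - h * c^-1 * b) (f0 := f - h * c^-1 * (a - l0)) :
  c \is a GRing.unit -> (l0%:M - A) *m V = 1%:M -> f0 * V 0 1 = - 1.
Proof.
move=> uc WV.
pose y := mxrows 3 [:: [:: h * c^-1; - 1; 0]; [:: 0; 0; 0]; [:: 0; 0; 0]].
have yW : y *m (l0%:M - A) =
    mxrows 3 [:: [:: f0; 0; 0]; [:: 0; 0; 0]; [:: 0; 0; 0]].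
  by rewrite /y /A /f0 /l0; mx_ring [:: c].
have /matrixP/(_ 0 1) : y = y *m (l0%:M - A) *m V by rewrite -mulmxA WV mulmx1.
rewrite yW !mxE !big_ord_recl big_ord0 !mxE /= => ->.
by rewrite !mul0r !addr0.
Qed.

Lemma HC3_rational a b c f g h p q r V
    (A := mxrows 3 [:: [:: a; b; c]; [:: f; g; h]; [:: p; q; r]])
    (l0 := g - h * c^-1 * b) (f0 := f - h * c^-1 * (a - l0)) :
  c \is a GRing.unit -> f0 \is a GRing.unit -> (l0%:M - A) *m V = 1%:M ->
  (p%:M - (r%:M - A) *m (c^-1)%:M *m (a%:M - A))
  - (q%:M - (r%:M - A) *m (c^-1 * b)%:M) *m V
    *m (f%:M - (h * c^-1)%:M *m (a%:M - A)) = 0.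
Proof.
move=> uc uf0 WV.
set W := _ - A in WV.
set P := p%:M - _; set Q := q%:M - _; set F := f%:M - _.
(* Rows are stored in the first row, and the column [X] in the first column, of square matrices, so
   that all products stay square. *)
pose y := mxrows 3 [:: [:: h * c^-1; - 1; 0]; [:: 0; 0; 0]; [:: 0; 0; 0]].
pose p0 := p - (r - l0) * c^-1 * (a - l0).
(* The last two columns of [X *m E0 + Y *m W = Q] involve only [Y], which is chosen to solve them
   with middle column 0; the first column then gives [X]. *)
pose X := mxrows 3 [:: [:: q - (r - a) * c^-1 * b + b * c^-1 * (l0 - a); 0; 0];
  [:: - p0 + f * c^-1 * b + h * c^-1 * b * c^-1 * (l0 - a); 0; 0];
  [:: p * c^-1 * b + q * c^-1 * (l0 - a); 0; 0]].
pose Y := mxrows 3 [:: [:: - (b * c^-1); 0; 0];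
  [:: (r - l0) * c^-1 - h * c^-1 * b * c^-1; 0; - 1]; [:: - (q * c^-1); 0; 0]].
pose E0 := mxrows 3 [:: [:: 1; 0; 0]; [:: 0; 0; 0]; [:: 0; 0; 0]] : 'M[S]_3.
pose E1 := mxrows 3 [:: [:: 0; 1; 0]; [:: 0; 0; 0]; [:: 0; 0; 0]] : 'M[S]_3.
have yW : y *m W = f0%:M *m E0.
  by rewrite /y /W /E0 /A /f0 /l0; mx_ring [:: c].
have yF : y *m F = - (f0%:M *m E1).
  by rewrite /y /F /E1 /A /f0 /l0; mx_ring [:: c].
have XY : X *m E0 + Y *m W = Q.
  by rewrite /X /Y /W /Q /E0 /A /p0 /l0; mx_ring [:: c].
have XF : Y *m F - X *m E1 = P.
  by rewrite /X /Y /P /F /E1 /A /p0 /l0; mx_ring [:: c].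
pose z := (f0^-1)%:M *m y.
have zW : z *m W = E0.
  by rewrite /z -mulmxA yW mulmxA -scalar_mxM mulVr // mul1mx.
have zF : z *m F = - E1.
  by rewrite /z -mulmxA yF mulmxN mulmxA -scalar_mxM mulVr // mul1mx.
have -> : Q *m V = X *m z + Y.
  by rewrite -XY -zW mulmxDl -!mulmxA WV !mulmx1.
by rewrite mulmxDl -mulmxA zF mulmxN (addrC (- _)) XF subrr.
Qed.

End HamiltonCayley.

(** * Study's determinant *)

Section BlockDeterminants.
Variable F : idomainType.

Lemma det_block_diag n (p q s t : 'rV[F]_n) :
  \det (block_mx (diag_mx p) (diag_mx q) (diag_mx s) (diag_mx t)) =
  \prod_i (p 0 i * t 0 i - q 0 i * s 0 i).
Proof.
pose C (v : 'rV[F]_n) := map_mx polyC v.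
(* Replacing [p] by [p + 'X] makes the upper left block regular. *)
pose pX : 'rV[{poly F}]_n := \row_i ('X + (p 0 i)%:P).
pose M := block_mx (diag_mx pX) (diag_mx (C q)) (diag_mx (C s)) (diag_mx (C t)).
have detM : \det M = \prod_i (pX 0 i * C t 0 i - C q 0 i * C s 0 i).
  have nz : \prod_i pX 0 i != 0.
    by apply/prodf_neq0 => i _; rewrite mxE monic_neq0 ?monicXaddC.
  apply: (mulIf nz).
  (* Diagonal matrices commute, so the upper right block of [M *m N] vanishes. *)
  pose N := block_mx 1%:M (- diag_mx (C q)) 0 (diag_mx pX).
  have -> : \prod_i pX 0 i = \det N by rewrite det_ublock det1 mul1r det_diag.
  rewrite -det_mulmx mulmx_block !mulmx1 !mulmx0 !addr0 !mulmxN !mulmx_diag.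
  rewrite (_ : - _ + _ = 0); last first.
    by apply/matrixP => i j; rewrite !mxE mulrC addNr.
  rewrite det_lblock det_diag det_ublock det1 mul1r det_diag mulrC; congr (_ * _).
  rewrite -raddfN -raddfD det_diag; apply: eq_bigr => i _.
  by rewrite !mxE; ring.
have := det_map_mx (horner_eval (0 : F)) M.
have hC v : map_mx (horner_eval (0 : F)) (C v) = v.
  by apply/matrixP => i j; rewrite !mxE /horner_eval hornerC.
have hX : map_mx (horner_eval (0 : F)) pX = p.
  apply/matrixP => i j; rewrite !mxE /horner_eval hornerD hornerX hornerC.
  by rewrite add0r ord1.
rewrite map_block_mx !map_diag_mx !hC hX => ->.
rewrite detM /= horner_evalE horner_prod; apply: eq_bigr => i _.
by rewrite !mxE !hornerE.
Qed.

(** A degeneration: conjugating all four blocks by the same diagonal matrix of powers of 'X keeps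
    the determinant, and at 'X = 0 only their diagonals remain, which is the case of
    [det_block_diag]. *)
Lemma det_block_trig n (P Q S T : 'M[F]_n) :
  is_trig_mx P -> is_trig_mx Q -> is_trig_mx S -> is_trig_mx T ->
  \det (block_mx P Q S T) = \prod_i (P i i * T i i - Q i i * S i i).
Proof.
move=> tP tQ tS tT.
pose L : 'M[{poly F}]_n := diag_mx (\row_i 'X^i).
(* [L A L^-1], whose value at ['X = 0] is the diagonal part of [A] *)
pose D (A : 'M[F]_n) : 'M[{poly F}]_n :=
  \matrix_(i, j) ((A i j)%:P * 'X^(i - j)).
pose M := block_mx P Q S T.
have LD A : is_trig_mx A -> L *m map_mx polyC A = D A *m L.
  move=> /is_trig_mxP tA; apply/matrixP => i j.
  rewrite mul_diag_mx mul_mx_diag !mxE.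
  (* Above the diagonal the truncated exponent [i - j] is 0, which is harmless because [A i j = 0]
     there. *)
  case: (leqP j i) => ji; last by rewrite tA // !(mulr0, mul0r).
  by rewrite -mulrA -exprD subnK // mulrC.
have detM : \det (map_mx polyC M) = \det (block_mx (D P) (D Q) (D S) (D T)).
  have nz : \det (block_mx L 0 0 L) != 0.
    rewrite det_ublock mulf_neq0 // det_diag; apply/prodf_neq0 => i _;
      by rewrite mxE -size_poly_eq0 size_polyXn.
  apply: (mulfI nz); rewrite -det_mulmx mulrC -det_mulmx.
  rewrite map_block_mx !mulmx_block !(mul0mx, mulmx0, addr0, add0r) !LD //.
have := det_map_mx (horner_eval (0 : F)) (map_mx polyC M).
have hC (A : 'M[F]_(n + n)) : map_mx (horner_eval (0 : F)) (map_mx polyC A) = A.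
  by apply/matrixP => i j; rewrite !mxE /horner_eval hornerC.
rewrite hC => ->; rewrite detM -det_map_mx map_block_mx.
have hD A : is_trig_mx A ->
    map_mx (horner_eval (0 : F)) (D A) = diag_mx (\row_i A i i).
  move=> /is_trig_mxP tA; apply/matrixP => i j.
  rewrite !mxE /horner_eval !hornerE.
  rewrite expr0n subn_eq0 -val_eqE /=; case: (ltngtP i j) => [ij|ij|/val_inj->].
  - by rewrite tA // mul0r.
  - by rewrite mulr0.
  - by rewrite mulr1.
rewrite !hD // det_block_diag; apply: eq_bigr => i _.
by rewrite !mxE.
Qed.

End BlockDeterminants.

(** * The complex form of quaternionic matrices and its determinant *)

Section StudyDeterminant.
Variable R : realType.
Implicit Types x y : quat R.

(** Expand (x + j y)(x' + j y') using z j = j conj(z) for complex z; the part after j gives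
    [quatYM]. *)
Lemma quatXM x y : quatX (x * y) = quatX x * quatX y - conjc (quatY x) * quatY y.
Proof.
by case: x y => [a b c d] [e f g h]; apply/eqP; rewrite eq_complex /=;
  apply/andP; split; apply/eqP; ring.
Qed.

Lemma quatYM x y : quatY (x * y) = quatY x * quatX y + conjc (quatX x) * quatY y.
Proof.
by case: x y => [a b c d] [e f g h]; apply/eqP; rewrite eq_complex /=;
  apply/andP; split; apply/eqP; ring.
Qed.

Lemma quatX_is_zmod_morphism : zmod_morphism (@quatX R).
Proof. by case=> [a b c d] [e f g h]. Qed.
HB.instance Definition _ := GRing.isZmodMorphism.Build (quat R) R[i] (@quatX R)
  quatX_is_zmod_morphism.

Lemma quatY_is_zmod_morphism : zmod_morphism (@quatY R).
Proof. by move=> [a b c d] [e f g h]; rewrite /quatY /=; congr Complex; ring. Qed.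
HB.instance Definition _ := GRing.isZmodMorphism.Build (quat R) R[i] (@quatY R)
  quatY_is_zmod_morphism.

Lemma map_quatXM n (A B : 'M[quat R]_n) : map_mx (@quatX R) (A *m B) =
  map_mx (@quatX R) A *m map_mx (@quatX R) B
  - map_mx (@conjc R) (map_mx (@quatY R) A) *m map_mx (@quatY R) B.
Proof.
apply/matrixP => i j; rewrite !mxE raddf_sum /= -sumrB.
by apply: eq_bigr => k _; rewrite quatXM !mxE.
Qed.

Lemma map_quatYM n (A B : 'M[quat R]_n) : map_mx (@quatY R) (A *m B) =
  map_mx (@quatY R) A *m map_mx (@quatX R) B
  + map_mx (@conjc R) (map_mx (@quatX R) A) *m map_mx (@quatY R) B.
Proof.
apply/matrixP => i j; rewrite !mxE raddf_sum /= -big_split.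
by apply: eq_bigr => k _; rewrite quatYM !mxE.
Qed.

Lemma map_conjcK n (A : 'M[R[i]]_n) : map_mx (@conjc R) (map_mx (@conjc R) A) = A.
Proof. by apply/matrixP => i j; rewrite !mxE conjcK. Qed.

Lemma complex_mxM n (A B : 'M[quat R]_n) :
  complex_mx (A *m B) = complex_mx A *m complex_mx B.
Proof.
rewrite /complex_mx mulmx_block map_quatXM map_quatYM.
rewrite !(raddfB, raddfD) /= !map_mxM /= !map_conjcK.
congr block_mx.
- by rewrite mulNmx.
- by rewrite mulNmx mulmxN addrC.
- by rewrite mulmxN addrC.
Qed.

Lemma complex_mx_inj n : injective (@complex_mx R n).
Proof.
move=> A B /eq_block_mx[/matrixP eX _ /matrixP eY _].
apply/matrixP => i j; move: (eX i j) (eY i j); rewrite !mxE.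
by case: (A i j) (B i j) => [a b c d] [e f g h] [-> ->] [-> /oppr_inj ->].
Qed.

Lemma complex_mx1 n : complex_mx 1%:M = 1%:M :> 'M[R[i]]_(n + n).
Proof.
rewrite [RHS]scalar_mx_block /complex_mx.
have -> : map_mx (@quatX R) 1%:M = 1%:M :> 'M_n.
  by apply/matrixP => i j; rewrite !mxE; case: eqP.
have -> : map_mx (@quatY R) 1%:M = 0 :> 'M_n.
  by apply/matrixP => i j; rewrite !mxE; case: eqP => _; apply/eqP;
    rewrite eq_complex /= oppr0 eqxx.
by rewrite map_mx0 oppr0 map_mx1.
Qed.

(* [complex_mx] identifies quaternionic matrices with the complex ones that are
   fixed by this automorphism, the conjugation by [j]. *)
Definition conj_by_j n (M : 'M[R[i]]_(n + n)) : 'M[R[i]]_(n + n) :=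
  let C := map_mx (@conjc R) M in
  block_mx (drsubmx C) (- dlsubmx C) (- ursubmx C) (ulsubmx C).

(** The map sends M to J conj(M) J^-1, where J has the block rows (0, -I) and (I, 0). *)
Lemma conj_by_jM n (M N : 'M[R[i]]_(n + n)) :
  conj_by_j (M *m N) = conj_by_j M *m conj_by_j N.
Proof.
rewrite /conj_by_j map_mxM /=; set C := map_mx _ M; set D := map_mx _ N.
rewrite -[in LHS](submxK C) -[in LHS](submxK D) !mulmx_block.
rewrite !(block_mxKul, block_mxKur, block_mxKdl, block_mxKdr).
move: (ulsubmx C) (ursubmx C) (dlsubmx C) (drsubmx C) => C1 C2 C3 C4.
move: (ulsubmx D) (ursubmx D) (dlsubmx D) (drsubmx D) => D1 D2 D3 D4.
by rewrite !mulNmx !mulmxN !opprK !opprD; congr block_mx; apply: addrC.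
Qed.

Lemma conj_by_j_complex_mx n (A : 'M[quat R]_n) :
  conj_by_j (complex_mx A) = complex_mx A.
Proof.
rewrite /conj_by_j /complex_mx map_block_mx map_mxN /= !map_conjcK.
by rewrite !(block_mxKul, block_mxKur, block_mxKdl, block_mxKdr) opprK.
Qed.

Lemma conj_by_j_fixed n (M : 'M[R[i]]_(n + n)) :
  conj_by_j M = M -> exists A, complex_mx A = M.
Proof.
move=> fixM.
(* The left half of [M] gives the complex components of [A], and fixedness determines the right
   half. The last sign is the one in [quatY]. *)
pose A : 'M[quat R]_n := \matrix_(i, j)
  let x := ulsubmx M i j in let y := dlsubmx M i j in
  Quat (complex.Re x) (complex.Im x) (complex.Re y) (- complex.Im y).
exists A.
have eX : map_mx (@quatX R) A = ulsubmx M.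
  by apply/matrixP => i j; rewrite !mxE /quatX /=; case: (M _ _).
have eY : map_mx (@quatY R) A = dlsubmx M.
  by apply/matrixP => i j; rewrite !mxE /quatY /= opprK; case: (M _ _).
rewrite -[RHS]submxK /complex_mx eX eY.
move: fixM; rewrite /conj_by_j -[in RHS](submxK M) => /eq_block_mx[_ <- _ <-].
by rewrite map_dlsubmx map_ulsubmx.
Qed.

(** The quantity under the root in [Sdet], kept complex so that multiplicativity requires neither
    reality nor positivity. *)
Definition study_det n (A : 'M[quat R]_n) := \det (complex_mx A).

Lemma study_detM n (A B : 'M[quat R]_n) :
  study_det (A *m B) = study_det A * study_det B.
Proof. by rewrite /study_det complex_mxM det_mulmx. Qed.

(** By uniqueness of inverses, the complex inverse of [complex_mx A] is again fixed by [conj_by_j],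
    so it comes from a quaternionic matrix. *)
Lemma study_det_neq0 n (A : 'M[quat R]_n) :
  study_det A != 0 -> mx_invertible A.
Proof.
move=> nz; have uA : complex_mx A \in unitmx by rewrite unitmxE unitfE.
have [|B eB] := @conj_by_j_fixed n (invmx (complex_mx A)).
  apply: (can_inj (mulmxK uA)).
  rewrite [RHS]mulVmx // -{2}conj_by_j_complex_mx -conj_by_jM mulVmx //.
  by rewrite -complex_mx1 conj_by_j_complex_mx.
by exists B; split; apply: complex_mx_inj;
  rewrite complex_mxM complex_mx1 eB ?mulmxV ?mulVmx.
Qed.

Lemma mx_invertibleN n (A : 'M[quat R]_n) :
  mx_invertible A -> mx_invertible (- A).
Proof.
by case=> B [AB BA]; exists (- B); split; rewrite mulNmx mulmxN opprK.
Qed.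

Lemma Sdet_neq0 n (A : 'M[quat R]_n) : Sdet A != 0 -> mx_invertible A.
Proof.
move=> nz; apply: study_det_neq0; apply: contraNneq nz => det0.
by rewrite /Sdet -/(study_det A) det0 sqrtr0.
Qed.

(** All four blocks of [complex_mx A] are lower triangular, and a diagonal entry x + j y contributes
    |x|^2 + |y|^2. *)
Lemma study_det_trig n (A : 'M[quat R]_n) : is_trig_mx A ->
  study_det A = (\prod_i qnormsq (A i i))%:C%C.
Proof.
move=> /is_trig_mxP tA.
have X0 : quatX (0 : quat R) = 0 by apply: raddf0.
have Y0 : quatY (0 : quat R) = 0 by apply: raddf0.
rewrite /study_det det_block_trig.
- rewrite rmorph_prod /=; apply: eq_bigr => i _; rewrite !mxE.
  case: (A i i) => a b c d; apply/eqP; rewrite eq_complex /qnormsq /=.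
  by apply/andP; split; apply/eqP; ring.
- by apply/is_trig_mxP => i j ij; rewrite !mxE tA.
- by apply/is_trig_mxP => i j ij; rewrite !mxE tA // Y0 raddf0 oppr0.
- by apply/is_trig_mxP => i j ij; rewrite !mxE tA.
- by apply/is_trig_mxP => i j ij; rewrite !mxE tA // X0 raddf0.
Qed.

(** The complex form is block diagonal with two copies of the permutation matrix, so the sign is
    squared. *)
Lemma study_det_perm n (s : 'S_n) : study_det (perm_mx s) = 1.
Proof.
pose P : 'M[R[i]]_n := perm_mx s.
have eX : map_mx (@quatX R) (perm_mx s) = P.
  by apply/matrixP => i j; rewrite !mxE; case: eqP.
have eY : map_mx (@quatY R) (perm_mx s) = 0.
  by apply/matrixP => i j; rewrite !mxE; case: eqP => _; apply/eqP;
    rewrite eq_complex /= oppr0 eqxx.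
rewrite /study_det /complex_mx eX eY map_mx0 oppr0 map_perm_mx.
by rewrite det_ublock det_perm -expr2 sqrr_sign.
Qed.

(** [U] and the permutation have Study determinant 1, and moving column [tnth t i] of [B] to
    position [i] makes [B] lower triangular. *)
Lemma Sdet_colop n (A U B : 'M[quat R]_n) (t : n.-tuple 'I_n) :
  A *m U = B -> is_trig_mx U -> (forall i, U i i = 1) -> uniq t ->
  (forall i j : 'I_n, (i < j)%N -> B i (tnth t j) = 0) ->
  Sdet A = \prod_i qnorm (B i (tnth t i)).
Proof.
move=> AU tU U1 /tuple_uniqP tinj B0.
pose T := col_perm (perm tinj) B.
have tT : is_trig_mx T.
  by apply/is_trig_mxP => i j ij; rewrite [T i j]mxE permE B0.
have -> : \prod_i qnorm (B i (tnth t i)) = \prod_i qnorm (T i i).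
  by apply: eq_bigr => i _; rewrite [T i i]mxE permE.
have dU : study_det U = 1.
  rewrite study_det_trig // big1 // => i _.
  by rewrite U1 /qnormsq /= expr1n expr0n /= !addr0.
have dA : study_det A = study_det T.
  by rewrite /T -AU col_permE !study_detM dU study_det_perm !mulr1.
rewrite /Sdet -/(study_det A) dA study_det_trig //=.
apply: (@pexpIrn _ 2) => //.
- exact: sqrtr_ge0.
- by apply: prodr_ge0 => i _; apply: sqrtr_ge0.
- have n0 (x : quat R) : 0 <= qnormsq x by rewrite !addr_ge0 ?sqr_ge0.
  rewrite sqr_sqrtr ?prodr_ge0 // -prodrXl; apply: eq_bigr => i _.
  by rewrite sqr_sqrtr.
Qed.

Lemma qnormM : {morph @qnorm R : x y / x * y}.
Proof.
move=> x y; rewrite /qnorm -sqrtrM; last by rewrite !addr_ge0 ?sqr_ge0.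
by case: x y => [a b c d] [e f g h]; congr Num.sqrt; rewrite /qnormsq /=; ring.
Qed.

Lemma qnorm_eq0 x : (qnorm x == 0) = (x == 0).
Proof.
by rewrite sqrtr_eq0 -qnormsq_eq0 eq_le [0 <= _]addr_ge0 ?andbT ?addr_ge0 ?sqr_ge0.
Qed.

End StudyDeterminant.

(** * Polynomials and their extensions *)

Section QuaternionicPolynomials.
Variable R : realType.
Implicit Types (q : quat R) (s : seq (quat R)) (m : qmonomial R) (P : qpoly R).

(** The last coefficient of the first monomial and the first one of the second merge into a single
    coefficient. *)
Fixpoint qmonomial_mul q s m : qmonomial R :=
  if s is q' :: s' then
    let m' := qmonomial_mul q' s' m in (q, m'.1 :: m'.2)
  else (q * m.1, m.2).
Definition qpoly_mul P Q : qpoly R :=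
  [seq qmonomial_mul m.1 m.2 m' | m <- P, m' <- Q].

Section Evaluation.
Variables (S : pzRingType) (f : quat R -> S) (x : S).
Hypothesis fM : {morph f : p q / p * q}.

Let step (acc : S) q := acc * x * f q.

Lemma foldl_stepM y z s : foldl step (y * z) s = y * foldl step z s.
Proof. by elim: s z => //= q s IH z; rewrite -IH /step !mulrA. Qed.

Lemma qmonomial_mulE q s m : qmonomial_eval f x (qmonomial_mul q s m) =
  qmonomial_eval f x (q, s) * qmonomial_eval f x m.
Proof.
rewrite /qmonomial_eval -/step /=; elim: s q => [|q' s IH] q /=.
  by rewrite fM foldl_stepM.
by rewrite /step !foldl_stepM IH mulrA.
Qed.

Lemma qpoly_mulE P Q :
  qpoly_eval f (qpoly_mul P Q) x = qpoly_eval f P x * qpoly_eval f Q x.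
Proof.
rewrite /qpoly_eval mulr_suml; elim: P => [|[q s] P IH]; first by rewrite !big_nil.
rewrite /qpoly_mul /= big_cat big_map big_cons IH mulr_sumr; congr (_ + _).
by apply: eq_bigr => m _; rewrite qmonomial_mulE.
Qed.

End Evaluation.

(** Both maps must come from one formal polynomial, as different ones may agree on the quaternions.
    The closure properties below avoid writing the polynomial out. *)
Definition polynomial_extension n (mu : quat R -> quat R)
    (muM : 'M[quat R]_n -> 'M[quat R]_n) :=
  exists P, qpoly_fun P =1 mu /\ @qpoly_ext R n P =1 muM.

Section Closure.
Variable n : nat.
Implicit Types mu nu : quat R -> quat R.
Implicit Types muM nuM : 'M[quat R]_n -> 'M[quat R]_n.

Lemma polynomial_extension_const q :
  polynomial_extension (fun=> q) (fun=> q%:M : 'M_n).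
Proof.
by exists [:: (q, [::])]; split=> x;
  rewrite /qpoly_fun /qpoly_ext /qpoly_eval big_seq1.
Qed.

Lemma polynomial_extension_id : polynomial_extension id (id : 'M_n -> 'M_n).
Proof.
exists [:: (1, [:: 1])]; split=> x;
  rewrite /qpoly_fun /qpoly_ext /qpoly_eval big_seq1 /qmonomial_eval /=.
  by rewrite mul1r mulr1.
by rewrite [LHS]mulmx1 [LHS]mul1mx.
Qed.

Lemma polynomial_extensionD mu nu muM nuM :
  polynomial_extension mu muM -> polynomial_extension nu nuM ->
  polynomial_extension (fun l => mu l + nu l) (fun B => muM B + nuM B).
Proof.
move=> [P [eP ePM]] [Q [eQ eQM]]; exists (P ++ Q); split=> x;
  by rewrite -?eP -?eQ -?ePM -?eQM /qpoly_fun /qpoly_ext /qpoly_eval big_cat.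
Qed.

Lemma polynomial_extensionM mu nu muM nuM :
  polynomial_extension mu muM -> polynomial_extension nu nuM ->
  polynomial_extension (fun l => mu l * nu l) (fun B => muM B *m nuM B).
Proof.
move=> [P [eP ePM]] [Q [eQ eQM]]; exists (qpoly_mul P Q); split=> x.
  by rewrite -eP -eQ; apply: qpoly_mulE.
by rewrite -ePM -eQM; apply: qpoly_mulE => p q; apply: scalar_mxM.
Qed.

Lemma polynomial_extensionB mu nu muM nuM :
  polynomial_extension mu muM -> polynomial_extension nu nuM ->
  polynomial_extension (fun l => mu l - nu l) (fun B => muM B - nuM B).
Proof.
move=> pmu /(polynomial_extensionM (polynomial_extension_const (- 1))).
case/(polynomial_extensionD pmu) => P [eP ePM]; exists P.
split=> x; rewrite ?eP ?ePM ?mulN1r //.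
by rewrite raddfN mulNmx mul1mx.
Qed.

End Closure.
End QuaternionicPolynomials.

Ltac polynomial_extension_tac :=
  first [ apply: polynomial_extension_const | apply: polynomial_extension_id
        | apply: polynomial_extensionB; polynomial_extension_tac
        | apply: polynomial_extensionM; polynomial_extension_tac ].

(** * Characteristic functions *)

Section CharacteristicFunctions.
Variable R : realType.

Definition admits_HC n (A : 'M[quat R]_n) :=
  exists (mu : quat R -> quat R) (muM : 'M[quat R]_n -> 'M[quat R]_n),
    [/\ characteristic_function A mu, mu_with_extension A mu muM & muM A = 0].

Lemma polynomial_admits_HC n (A : 'M[quat R]_n) mu muM :
  polynomial_extension mu muM -> characteristic_function A mu -> muM A = 0 ->
  admits_HC A.
Proof.
move=> [P [eP ePM]] [k k0 ch] muA; exists (qpoly_fun P), (@qpoly_ext R n P).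
split; [by exists k => // l; rewrite eP|exact: Type_P|by rewrite ePM].
Qed.

(** [Sdet_colop] in list form: for concrete lists the side conditions reduce to computations. The
    pivot of row [i] of [B] is in column [nth 0 t i]. *)
Lemma Sdet_mxrows n (A : 'M[quat R]_n) s B t :
  A *m mxrows n s = mxrows n B -> perm_eq t (iota 0 n) ->
  (forall i, (i < n)%N -> (nth [::] s i)`_i = 1) ->
  (forall i j, (i < j < n)%N ->
     (nth [::] s i)`_j = 0 /\ (nth [::] B i)`_(nth 0%N t j) = 0) ->
  Sdet A = \prod_(i < n) qnorm (nth [::] B i)`_(nth 0%N t i).
Proof.
move=> AU pt s1 s0.
have st : size t = n by rewrite (perm_size pt) size_iota.
have ltn (i : 'I_n) : (nth 0%N t i < n)%N.
  have: nth 0%N t i \in t by rewrite mem_nth // st.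
  by rewrite (perm_mem pt) mem_iota.
pose tau := [tuple Ordinal (ltn i) | i < n].
have tauE i : tnth tau i = nth 0%N t i :> nat by rewrite tnth_mktuple.
rewrite (Sdet_colop (t := tau) AU).
- by apply: eq_bigr => i _; rewrite mxE tauE.
- by apply/is_trig_mxP => i j ij; rewrite mxE (s0 i j _).1 ?ij /=.
- by move=> i; rewrite mxE s1.
- apply/tuple_uniqP => i j /(congr1 val); rewrite /= !tauE => /eqP.
  by rewrite nth_uniq ?st // ?(perm_uniq pt) ?iota_uniq // => /eqP/val_inj.
- by move=> i j ij; rewrite mxE tauE (s0 i j _).2 ?ij /=.
Qed.

Lemma Sdet_mxrows2 (A : 'M[quat R]_2) u B i j :
  A *m mxrows 2 [:: [:: 1; 0]; [:: u; 1]] = mxrows 2 B ->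
  perm_eq [:: i; j] [:: 0; 1]%N -> (nth [::] B 0)`_j = 0 ->
  Sdet A = qnorm (nth [::] B 0)`_i * qnorm (nth [::] B 1)`_j.
Proof.
move=> AU pt B0j; rewrite (Sdet_mxrows AU pt).
- by rewrite !big_ord_recl big_ord0 mulr1.
- by case=> [|[|]].
- by case=> [|[|i0]] [|[|j0]] //; rewrite andbF.
Qed.

Lemma Sdet_mxrows3 (A : 'M[quat R]_3) u v w B i j k :
  A *m mxrows 3 [:: [:: 1; 0; 0]; [:: u; 1; 0]; [:: v; w; 1]] = mxrows 3 B ->
  perm_eq [:: i; j; k] [:: 0; 1; 2]%N ->
  (nth [::] B 0)`_j = 0 -> (nth [::] B 0)`_k = 0 -> (nth [::] B 1)`_k = 0 ->
  Sdet A = qnorm (nth [::] B 0)`_i * qnorm (nth [::] B 1)`_j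
           * qnorm (nth [::] B 2)`_k.
Proof.
move=> AU pt B0j B0k B1k; rewrite (Sdet_mxrows AU pt).
- by rewrite !big_ord_recl big_ord0 mulr1 mulrA.
- by case=> [|[|[|]]].
- by case=> [|[|[|i0]]] [|[|[|j0]]] //; rewrite andbF.
Qed.

Lemma quat_unit (x : quat R) : (x \is a GRing.unit) = (x != 0).
Proof. by []. Qed.

Lemma qnorm_gt0 (x : quat R) : (0 < qnorm x) = (x != 0).
Proof. by rewrite lt_def sqrtr_ge0 andbT qnorm_eq0. Qed.

Lemma characteristic_functionP n (A : 'M[quat R]_n) mu k : 0 < k ->
  (forall l, Sdet (A - l%:M) = k * qnorm (mu l)) ->
  characteristic_function A mu.
Proof.
move=> k0 e; exists k^-1; first by rewrite invr_gt0.
by move=> l; rewrite e mulKf ?gt_eqF.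
Qed.

Lemma admits_HC1 (A : 'M[quat R]_1) : admits_HC A.
Proof.
pose a := A 0 0.
apply: (@polynomial_admits_HC _ _ (fun l => a - l) (fun B => a%:M - B)).
- by polynomial_extension_tac.
- apply: (@characteristic_functionP _ _ _ 1) => // l.
  rewrite (@Sdet_colop _ _ (A - l%:M) 1%:M _ [tuple 0] (mulmx1 _)) //.
  + by rewrite big_ord1 (ord1 (tnth _ _)) !mxE eqxx mul1r.
  + by move=> i; rewrite mxE eqxx.
  + by move=> i j; rewrite !ord1.
- by apply/matrixP => i j; rewrite !ord1 !mxE eqxx subrr.
Qed.

Lemma admits_HC2 a b c d : admits_HC (mxrows 2 [:: [:: a; b]; [:: c; d]]).
Proof.
set A := mxrows _ _.
have [b0|nb] := eqVneq b 0.
  apply: (@polynomial_admits_HC _ _ (fun l => (d - l) * (a - l))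
    (fun B => (d%:M - B) *m (a%:M - B))).
  - by polynomial_extension_tac.
  - apply: (@characteristic_functionP _ _ _ 1) => // l.
    rewrite (@Sdet_mxrows2 _ 0 [:: [:: a - l; 0]; [:: c; d - l]] 0 1) //.
      by rewrite qnormM mul1r mulrC.
    by rewrite /A b0; mx_ring (@nil (quat R)).
  - by rewrite /A b0 HC2_lower.
have ub : b \is a GRing.unit by [].
apply: (@polynomial_admits_HC _ _ (fun l => c - (d - l) * b^-1 * (a - l))
  (fun B => c%:M - (d%:M - B) *m b^-1%:M *m (a%:M - B))).
- by polynomial_extension_tac.
- apply: (@characteristic_functionP _ _ _ (qnorm b)); rewrite ?qnorm_gt0 // => l.
  (* The pivot [b] clears the entry [a - l] to its left, and the characteristic function appears
     below it. *)
  rewrite (@Sdet_mxrows2 _ (- (b^-1 * (a - l)))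
    [:: [:: 0; b]; [:: c - (d - l) * b^-1 * (a - l); d - l]] 1 0) //.
  by rewrite /A; mx_ring [:: b].
- exact: HC2.
Qed.

Lemma admits_HC3_lower a f g p q r :
  admits_HC (mxrows 3 [:: [:: a; 0; 0]; [:: f; g; 0]; [:: p; q; r]]).
Proof.
apply: (@polynomial_admits_HC _ _ (fun l => (r - l) * (g - l) * (a - l))
  (fun B => (r%:M - B) *m (g%:M - B) *m (a%:M - B))).
- by polynomial_extension_tac.
- apply: (@characteristic_functionP _ _ _ 1) => // l.
  rewrite (@Sdet_mxrows3 _ 0 0 0
    [:: [:: a - l; 0; 0]; [:: f; g - l; 0]; [:: p; q; r - l]] 0 1 2) //.
    by rewrite !qnormM /=; ring.
  by mx_ring (@nil (quat R)).
- exact: HC3_lower.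
Qed.

Lemma admits_HC3_lblock12 a f g h p q r : h != 0 ->
  admits_HC (mxrows 3 [:: [:: a; 0; 0]; [:: f; g; h]; [:: p; q; r]]).
Proof.
move=> nh; have uh : h \is a GRing.unit by [].
pose mu l := q - (r - l) * h^-1 * (g - l).
apply: (@polynomial_admits_HC _ _ (fun l => mu l * (a - l))
  (fun B => (q%:M - (r%:M - B) *m h^-1%:M *m (g%:M - B)) *m (a%:M - B))).
- by polynomial_extension_tac.
- apply: (@characteristic_functionP _ _ _ (qnorm h)); rewrite ?qnorm_gt0 // => l.
  rewrite (@Sdet_mxrows3 _ 0 0 (- (h^-1 * (g - l)))
    [:: [:: a - l; 0; 0]; [:: f; 0; h]; [:: p; mu l; r - l]] 0 2 1) //.
    by rewrite !qnormM /=; ring.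
  by rewrite /mu; mx_ring [:: h].
- exact: HC3_lblock12.
Qed.

Lemma admits_HC3_lblock21 a b f g p q r : b != 0 ->
  admits_HC (mxrows 3 [:: [:: a; b; 0]; [:: f; g; 0]; [:: p; q; r]]).
Proof.
move=> nb; have ub : b \is a GRing.unit by [].
pose mu l := f - (g - l) * b^-1 * (a - l).
apply: (@polynomial_admits_HC _ _ (fun l => (r - l) * mu l)
  (fun B => (r%:M - B) *m (f%:M - (g%:M - B) *m b^-1%:M *m (a%:M - B)))).
- by polynomial_extension_tac.
- apply: (@characteristic_functionP _ _ _ (qnorm b)); rewrite ?qnorm_gt0 // => l.
  rewrite (@Sdet_mxrows3 _ (- (b^-1 * (a - l))) 0 0
    [:: [:: 0; b; 0]; [:: mu l; g - l; 0];
        [:: p - q * b^-1 * (a - l); q; r - l]] 1 0 2) //.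
    by rewrite !qnormM /=; ring.
  by rewrite /mu; mx_ring [:: b].
- exact: HC3_lblock21.
Qed.

Lemma admits_HC3_hessenberg a b f g h p q r : b != 0 -> h != 0 ->
  admits_HC (mxrows 3 [:: [:: a; b; 0]; [:: f; g; h]; [:: p; q; r]]).
Proof.
move=> nb nh.
have ub : b \is a GRing.unit by [].
have uh : h \is a GRing.unit by [].
pose F l := f - (g - l) * b^-1 * (a - l).
pose mu l := p - q * b^-1 * (a - l) - (r - l) * h^-1 * F l.
apply: (@polynomial_admits_HC _ _ mu
  (fun B => p%:M - q%:M *m b^-1%:M *m (a%:M - B)
   - (r%:M - B) *m h^-1%:M *m (f%:M - (g%:M - B) *m b^-1%:M *m (a%:M - B)))).
- by polynomial_extension_tac.
- apply: (@characteristic_functionP _ _ _ (qnorm b * qnorm h)) => [|l].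
    by rewrite mulr_gt0 ?qnorm_gt0.
  (* The pivot [b] clears [a - l], which turns the entry below into [F l]; the pivot [h] then clears
     [F l]. *)
  rewrite (@Sdet_mxrows3 _ (- (b^-1 * (a - l))) (- (h^-1 * F l)) 0
    [:: [:: 0; b; 0]; [:: 0; g - l; h]; [:: mu l; q; r - l]] 1 2 0) //.
  by rewrite /mu /F; mx_ring [:: b; h].
- exact: HC3_hessenberg.
Qed.

Lemma rat_fun_characteristic (A : 'M[quat R]_3) : A 0 2 != 0 ->
  forall l, Sdet (A - l%:M) = qnorm (A 0 2) * qnorm (rat_fun A l).
Proof.
rewrite /rat_fun /rat_q0 /rat_f0 /rat_l0 (mxrows3_eta A) !mxE /=.
set a := A 0 0; set b := A 0 1; set c := A 0 2.
set f := A 1 0; set g := A 1 1; set h := A 1 2.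
set p := A 2 0; set q := A 2 1; set r := A 2 2 => nc l.
have uc : c \is a GRing.unit by [].
set l0 := g - _; set F := f - h * c^-1 * (a - l).
set Q := q - (r - l) * c^-1 * b; set P := p - (r - l) * c^-1 * (a - l).
have [->|nl] := eqVneq l l0.
  (* Clearing the first row with the pivot [c] leaves [F] and [l0 - l] in the second. At [l = l0]
     the latter is 0, so the pivots below are [f0] and [q0]. *)
  rewrite (@Sdet_mxrows3 _ 0 (- (c^-1 * (a - l0))) (- (c^-1 * b))
    [:: [:: 0; 0; c]; [:: f - h * c^-1 * (a - l0); 0; h];
        [:: p - (r - l0) * c^-1 * (a - l0); q - (r - l0) * c^-1 * b; r - l0]]
    2 0 1) //.
    by rewrite !qnormM /=; ring.
  by rewrite /l0; mx_ring [:: c].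
pose d := l0 - l; rewrite -/d.
have ud : d \is a GRing.unit by rewrite quat_unit subr_eq0 eq_sym.
(* Here [d] is a nonzero pivot and clears [F] too; the lower left entry of [U] composes this
   operation with those of the pivot [c]. *)
rewrite (@Sdet_mxrows3 _ (- (d^-1 * F))
    (- (c^-1 * (a - l)) + c^-1 * b * d^-1 * F) (- (c^-1 * b))
    [:: [:: 0; 0; c]; [:: 0; d; h]; [:: P - Q * d^-1 * F; Q; r - l]] 2 1 0) //.
  by rewrite !qnormM /=; ring.
(* Eliminating [g] makes [d] an independent atom, which [nc_ring] can cancel against [d^-1]. *)
have -> : g = d + l + h * c^-1 * b by rewrite /d /l0; nc_ring [:: c].
by rewrite /P /Q /F; mx_ring [:: c; d].
Qed.

Lemma rat_admits_HC (A : 'M[quat R]_3) : A 0 2 != 0 -> admits_HC A.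
Proof.
move=> nc; exists (rat_fun A), (rat_ext A); split; last 1 first.
- rewrite /rat_ext; case: asboolP => [invW|nW].
    set V := mx_inv _.
    have [WV _] : mx_inverse_of ((rat_l0 A)%:M - A) V.
      by case: invW => C invC; rewrite /V /mx_inv; apply: xgetPex; exists C.
    have uc : A 0 2 \is a GRing.unit by [].
    have := @HC3_rational_f0 _ (A 0 0) (A 0 1) (A 0 2) (A 1 0) (A 1 1) (A 1 2)
      (A 2 0) (A 2 1) (A 2 2) V uc.
    have := @HC3_rational _ (A 0 0) (A 0 1) (A 0 2) (A 1 0) (A 1 1) (A 1 2)
      (A 2 0) (A 2 1) (A 2 2) V uc.
    rewrite -mxrows3_eta => HC /(_ WV) f0V.
    rewrite HC ?mulmx0 // quat_unit; apply/eqP => f00.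
    by move/eqP: f0V; rewrite f00 mul0r eq_sym oppr_eq0 oner_eq0.
  have /eqP : Sdet (A - (rat_l0 A)%:M) = 0.
    apply/eqP; apply: contra_notT nW => /Sdet_neq0/mx_invertibleN.
    by rewrite opprB.
  rewrite rat_fun_characteristic // mulf_eq0 !qnorm_eq0 (negPf nc) /=.
  by rewrite /rat_fun eqxx => /eqP ->; rewrite raddf0.
- apply: characteristic_functionP; last exact: rat_fun_characteristic.
  by rewrite qnorm_gt0.
- exact: Type_R.
Qed.

End CharacteristicFunctions.

Theorem theoremA (R : realType) (n : nat) (hn : n \in [:: 1; 2; 3]%N)
    (A : 'M[quat R]_n) :
  exists (mu : quat R -> quat R) (muM : 'M[quat R]_n -> 'M[quat R]_n),
    [/\ characteristic_function A mu,
        mu_with_extension A mu muM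
      & muM A = 0].
Proof.
case: n hn A => [|[|[|[|n]]]] //= _ A; rewrite -/(admits_HC A).
- exact: admits_HC1.
- by rewrite (mxrows2_eta A); apply: admits_HC2.
have [c0|nc] := eqVneq (A 0 2) 0; last exact: rat_admits_HC.
rewrite (mxrows3_eta A) c0.
have [b0|nb] := eqVneq (A 0 1) 0; have [h0|nh] := eqVneq (A 1 2) 0.
- by rewrite b0 h0; apply: admits_HC3_lower.
- by rewrite b0; apply: admits_HC3_lblock12.
- by rewrite h0; apply: admits_HC3_lblock21.
- exact: admits_HC3_hessenberg.
Qed.
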